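(* Let $E$ be a countable Borel equivalence relation on a Polish space $X$. Let $(G_n)_{n\in\mathbb{N}}$ be an increasing sequence (i.e. $G_n\subseteq G_{n+1}$ for all $n$) of bounded degree Borel graphs on $X$ such that $\bigcup_n G_n=E$, and let $f:\mathbb{N}\to\mathbb{N}$ be such that $f(n+1)\ge 2\cdot(f(n)+1)$ for all $n\in\mathbb{N}$. Moreover, assume that $B_n\subseteq X$ ($n\in\mathbb{N}$) are Borel sets such that every $B_n$ is $f(n)$-separated in $G_n$. Then the restriction of $E$ to $B$ is hyperfinite, where $B=\{x\in X: x\in B_n \text{ for infinitely many } n\}$.
   Context: A countable Borel equivalence relation (CBER) on a Polish (or standard Borel) space $X$ is an equivalence relation on $X$ that is Borel as a subset of $X^2$ and has all classes countable. For $E$ on $X$ and $F$ on $Y$, a Borel reduction of $E$ to $F$ is a Borel map $\phi:X\to Y$ with $x\,E\,x'\iff\phi(x)\,F\,\phi(x')$ for all $x,x'\in X$. A CBER is hyperfinite if it admits a Borel reduction to $\mathbb{E}_0$, the relation of eventual equality on $2^{\mathbb{N}}$. The restriction of $E$ to a Borel set $Y\subseteq X$ is $E\cap Y^2$, a CBER on $Y$. A graph on $X$ is a symmetric binary relation $G\subseteq X^2$ with vertex set $X$; graphs are not assumed to be irreflexive (loops are allowed). It is Borel if it is a Borel subset of $X^2$. It has bounded degree if there is a finite uniform bound on the number of $G$-neighbours of a vertex (for a sequence of graphs, the bound may depend on the graph). $\mathrm{dist}_G(x,x')$ is the graph distance, i.e. the least length of a $G$-path from $x$ to $x'$, and $\infty$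 if there is none. A set $B\subseteq X$ is $k$-separated in $G$ if $\mathrm{dist}_G(x,x')>k$ for all distinct $x,x'\in B$. *)

(* Defs.v *)
From HB Require Import structures.
From mathcomp Require Import all_boot all_order all_algebra.
From mathcomp Require Import all_classical all_reals all_analysis.

Set Implicit Arguments.
Unset Strict Implicit.
Unset Printing Implicit Defensive.

Import Order.TTheory GRing.Theory Num.Theory.
Local Open Scope classical_set_scope.

Section Polish.
Context (R : realType).
Local Open Scope ring_scope.

Definition is_metric (T : Type) (d : T -> T -> R) : Prop :=
  [/\ forall x y, 0 <= d x y,
      forall x y, d x y = 0 <-> x = y,
      forall x y, d x y = d y x &
      forall x y z, d x z <= d x y + d y z].

Definition metric_ball (T : Type) (d : T -> T -> R) (x : T) (e : R) : set T :=
  [set y | d x y < e].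

Definition metrizes (T : topologicalType) (d : T -> T -> R) : Prop :=
  forall U : set T, open U <->
    forall x, U x -> exists2 e, 0 < e & metric_ball d x e `<=` U.

Definition complete_metric (T : Type) (d : T -> T -> R) : Prop :=
  forall u : nat -> T,
    (forall e, 0 < e -> exists N, forall m n,
      (N <= m)%N -> (N <= n)%N -> d (u m) (u n) < e) ->
    exists l, forall e, 0 < e -> exists N, forall n, (N <= n)%N -> d (u n) l < e.

(* All realTypes are isomorphic, so the choice of R is immaterial; the empty
   space is Polish. *)
Definition polish (T : topologicalType) : Prop :=
  (exists2 D : set T, countable D & dense D) /\
  exists d : T -> T -> R, [/\ is_metric d, metrizes d & complete_metric d].

End Polish.

(* The sigma-algebra generated by the open sets. The library's measurableType
   is not used because it excludes empty carriers. *)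
Definition borel (T : topologicalType) : set (set T) := <<s @open T >>.

Definition borel_map (T U : topologicalType) (phi : T -> U) : Prop :=
  forall A : set U, borel A -> borel (phi @^-1` A).

Definition is_equivalence (T : Type) (E : set (T * T)) : Prop :=
  [/\ forall x, E (x, x),
      forall x y, E (x, y) -> E (y, x) &
      forall x y z, E (x, y) -> E (y, z) -> E (x, z)].

Definition cber (T : topologicalType) (E : set (T * T)) : Prop :=
  [/\ is_equivalence E, borel E & forall x, countable [set y | E (x, y)]].

Definition borel_reduction (T U : topologicalType)
    (E : set (T * T)) (F : set (U * U)) (phi : T -> U) : Prop :=
  borel_map phi /\ forall x x', E (x, x') <-> F (phi x, phi x').

Definition E0 : set (cantor_space * cantor_space) :=
  [set uv | exists N : nat, forall n : nat, (N <= n)%N -> uv.1 n = uv.2 n].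

Definition hyperfinite (T : topologicalType) (E : set (T * T)) : Prop :=
  cber E /\ exists phi : T -> cantor_space, borel_reduction E E0 phi.

(* E `&` (Y `*` Y), as a relation on the subtype Y; the library gives Y the
   subspace topology, whose Borel sets are the traces on Y of those of T. *)
Definition restriction (T : Type) (E : set (T * T)) (Y : set T) :
    set (set_type Y * set_type Y) :=
  [set p | E (set_val p.1, set_val p.2)].
Arguments restriction {T} E Y _.

Definition borel_graph (T : topologicalType) (G : set (T * T)) : Prop :=
  (forall x y, G (x, y) -> G (y, x)) /\ borel G.

Definition bounded_degree (T : Type) (G : set (T * T)) : Prop :=
  exists k : nat, forall x, ([set y | G (x, y)] #<= `I_k)%card.

Definition gpath (T : Type) (G : set (T * T)) (x y : T) (n : nat) : Prop :=
  exists p : nat -> T,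
    [/\ p 0%N = x, p n = y & forall i, (i < n)%N -> G (p i, p i.+1)].

Lemma gpath_ex (T : Type) (G : set (T * T)) (x y : T) :
  (exists n, gpath G x y n) -> exists n, `[< gpath G x y n >].
Proof. by case=> n xyn; exists n; apply/asboolP. Qed.

(* None stands for infinite distance. *)
Definition gdist (T : Type) (G : set (T * T)) (x y : T) : option nat :=
  if pselect (exists n, gpath G x y n) is left xy
  then Some (ex_minn (gpath_ex xy)) else None.

Definition dist_gt (d : option nat) (k : nat) : Prop :=
  if d is Some n then (k < n)%N else True.

Definition separated_in (T : Type) (G : set (T * T)) (k : nat) (B : set T) :
    Prop :=
  forall x x', B x -> B x' -> x <> x' -> dist_gt (gdist G x x') k.

(* Main.v *)
Require Import Defs.
From HB Require Import structures.
From mathcomp Require Import all_boot all_order all_algebra.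
From mathcomp Require Import all_classical all_reals all_analysis.
From mathcomp Require Import zify.

Set Implicit Arguments.
Unset Strict Implicit.
Unset Printing Implicit Defensive.

Import Order.TTheory GRing.Theory Num.Theory.
Local Open Scope classical_set_scope.

(* Each [G n] has finite sections, so by the Lusin-Novikov theorem it is covered
   by countably many graphs of Borel functions; hence quantifiers bounded by [E]
   preserve Borel sets. Let [h n] move a point to the unique point of [B n] at
   [G n]-distance at most [f n / 2], if there is one, and let
   [p n] be [h (n-1) o ... o h 0]. For [n > 0] the growth of [f] makes [p n] move
   points by less than [f n / 2], so if [x] is in [B n] and [(x, y)] in [G n],
   then [p n.+1 x = x = p n.+1 y]. Thus on the points lying in infinitely many [B n],
   [E] is the increasing union of the kernels of the finite-to-one Borel maps
   [p n], and such a union is reduced to [E0] by recording the fibres of the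
   [p n]. Lusin-Novikov is derived from Novikov's separation theorem for
   analytic sets, after X is coded by a Borel subset of the Baire space. *)

(** * Closure of sigma-algebras under countable logical operations *)

Section SigmaAlgebra.
Context (T : Type) (S : set (set T)) (hS : sigma_algebra setT S).

Lemma sigma_not (P : T -> Prop) : S [set x | P x] -> S [set x | ~ P x].
Proof.
by case: hS => _ hC _ /hC; congr (S _); apply/seteqP; split=> x //= -[].
Qed.

Lemma sigma_ex (P : nat -> T -> Prop) :
  (forall n, S [set x | P n x]) -> S [set x | exists n, P n x].
Proof.
case: hS => _ _ hU /hU; congr (S _).
by apply/seteqP; split=> x /= [n]; [move=> _|]; exists n.
Qed.

Lemma sigma_all (P : nat -> T -> Prop) :
  (forall n, S [set x | P n x]) -> S [set x | forall n, P n x].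
Proof.
move=> hP; have /sigma_not := sigma_ex (fun n => sigma_not (hP n)).
congr (S _); apply/seteqP; split=> x /= hx.
  by move=> n; apply: contrapT => ?; apply: hx; exists n.
by case.
Qed.

Lemma sigma_cst (P : Prop) : S [set x | P].
Proof.
have h0 : S [set x | False] by case: hS => h0 _ _; move: h0; congr (S _); apply/seteqP; split.
have [hP|hP] := pselect P.
  by have := sigma_not h0; congr (S _); apply/seteqP; split=> x //= _ [].
by move: h0; congr (S _); apply/seteqP; split.
Qed.

Lemma sigma_or (P Q : T -> Prop) :
  S [set x | P x] -> S [set x | Q x] -> S [set x | P x \/ Q x].
Proof.
move=> hP hQ.
have : S [set x | exists n, (if n is 0 then P x else Q x)].
  by apply: (@sigma_ex (fun n x => if n is 0 then P x else Q x)) => -[].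
congr (S _); apply/seteqP; split=> x /=; first by case=> -[|n] h; [left|right].
by case=> h; [exists 0|exists 1].
Qed.

Lemma sigma_and (P Q : T -> Prop) :
  S [set x | P x] -> S [set x | Q x] -> S [set x | P x /\ Q x].
Proof.
move=> hP hQ; have := sigma_not (sigma_or (sigma_not hP) (sigma_not hQ)).
congr (S _); apply/seteqP; split=> x /=; first by move=> /not_orP[/contrapT ? /contrapT].
by case=> hp hq [].
Qed.

Lemma sigma_imp (P Q : T -> Prop) :
  S [set x | P x] -> S [set x | Q x] -> S [set x | P x -> Q x].
Proof.
move=> hP hQ; have := sigma_or (sigma_not hP) hQ.
congr (S _); apply/seteqP; split=> x /=; first by case.
by move=> h; have [/h|] := pselect (P x); [right|left].
Qed.

Lemma sigma_ex_count (I : countType) (P : I -> T -> Prop) :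
  (forall i, S [set x | P i x]) -> S [set x | exists i, P i x].
Proof.
move=> hP.
have : S [set x | exists n, if unpickle n is Some i then P i x else False].
  apply: (@sigma_ex (fun n x => if unpickle n is Some i then P i x else False)) => n.
  by case: unpickle => [i|]; [apply: hP|apply: sigma_cst].
congr (S _); apply/seteqP; split=> x /=.
  by case=> n; case: unpickle => // i; exists i.
by case=> i Pi; exists (pickle i); rewrite pickleK.
Qed.

Lemma sigma_eq_count (I : countType) (u v : T -> I) :
  (forall i, S [set x | u x = i]) -> (forall i, S [set x | v x = i]) ->
  S [set x | u x = v x].
Proof.
move=> hu hv; have := sigma_ex_count (fun i => sigma_and (hu i) (hv i)).
congr (S _); apply/seteqP; split=> x /=; first by case=> i [-> ->].
by move=> ->; exists (v x).
Qed.

Lemma sigma_fun_count (I : countType) (u : T -> I) (P : I -> T -> Prop) :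
  (forall i, S [set x | u x = i]) -> (forall i, S [set x | P i x]) ->
  S [set x | P (u x) x].
Proof.
move=> hu hP; have := sigma_ex_count (fun i => sigma_and (hu i) (hP i)).
congr (S _); apply/seteqP; split=> x /=; first by case=> i [->].
by exists (u x).
Qed.

End SigmaAlgebra.

Lemma sigma_preimage (T U : Type) (S : set (set T)) (H : set (set U)) (f : T -> U) :
  sigma_algebra setT S -> (forall A, H A -> S (f @^-1` A)) ->
  forall A, <<s H >> A -> S (f @^-1` A).
Proof.
move=> hS hf; apply: smallest_sub => //; split.
- by rewrite preimage_set0; case: hS.
- move=> A /= hA; rewrite setTD preimage_setC.
  by case: hS => _ /(_ _ hA); rewrite setTD.
- by move=> F hF; rewrite preimage_bigcup; case: hS => _ _; apply.
Qed.

(** * Borel sets and Borel functions on the Baire space *)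

Definition baire := nat -> nat.

Definition agree (n : nat) (p q : baire) := forall i, i < n -> p i = q i.

Definition bor : set (set baire) :=
  <<s [set A | exists i k, A = [set p | p i = k]] >>.

Lemma bor_sigma : sigma_algebra setT bor.
Proof. exact: smallest_sigma_algebra. Qed.

Definition borfun (f : baire -> baire) := forall i k, bor [set x | f x i = k].

Lemma bor_coord i k : bor [set p | p i = k].
Proof. by apply: sub_sigma_algebra; exists i, k. Qed.

Lemma bor_pre (f : baire -> baire) (A : set baire) :
  borfun f -> bor A -> bor [set x | A (f x)].
Proof.
move=> hf; apply: (sigma_preimage bor_sigma) => _ [i [k ->]]; exact: hf.
Qed.

Lemma borfun_id : borfun id.
Proof. exact: bor_coord. Qed.

Lemma borfun_comp f g : borfun f -> borfun g -> borfun (fun x => f (g x)).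
Proof. by move=> hf hg i k; apply: (bor_pre hg (hf i k)). Qed.

Lemma bor_eqfun f g : borfun f -> borfun g -> bor [set x | f x = g x].
Proof.
move=> hf hg.
have := sigma_all bor_sigma (fun i => sigma_eq_count bor_sigma (hf i) (hg i)).
congr bor; apply/seteqP; split=> x /= h; last by rewrite h.
by apply/funext.
Qed.

Definition least (P : nat -> Prop) : nat :=
  if pselect (exists k, `[< P k >]) is left h then ex_minn h else 0.

Lemma leastP (P : nat -> Prop) : (exists k, P k) ->
  P (least P) /\ forall k, k < least P -> ~ P k.
Proof.
move=> [k Pk]; rewrite /least; case: pselect => [h|[]]; last by exists k; apply/asboolP.
case: ex_minnP => m /asboolP Pm hm; split=> // j jm /asboolP /hm.
by rewrite leqNgt jm.
Qed.

Lemma least0 (P : nat -> Prop) : ~ (exists k, P k) -> least P = 0.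
Proof.
by move=> nP; rewrite /least; case: pselect => // h; case: nP; case: h => k /asboolP; exists k.
Qed.

(** Being the first success is a countable Boolean combination of the given sets. This makes the
    choices of indices below measurable. *)
Lemma sigma_least (T : Type) (S : set (set T)) (P : nat -> T -> Prop) k :
  sigma_algebra setT S -> (forall j, S [set x | P j x]) ->
  S [set x | least (P^~ x) = k].
Proof.
move=> hS hP.
have : S [set x | (P k x /\ forall j, j < k -> ~ P j x) \/
    ((~ exists k, P k x) /\ k = 0)].
  apply: (sigma_or hS); apply: (sigma_and hS) => //.
  - apply: (@sigma_all _ _ hS (fun j x => j < k -> ~ P j x)) => j.
    apply: (sigma_imp hS); first exact: (sigma_cst hS).
    exact: (sigma_not hS).
  - by apply: (sigma_not hS); apply: (sigma_ex hS).
  - exact: (sigma_cst hS).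
congr S; apply/seteqP; split=> x /=.
  case=> [[Pk hk]|[nP ->]]; last exact: least0.
  have [Pl hl] := leastP (ex_intro (P^~ x) k Pk).
  by case: (ltngtP (least (P^~ x)) k) => // [/hk|/hl].
have [/leastP[Pl hl] <-|nP] := pselect (exists k, P k x); first by left.
by rewrite least0// => <-; right.
Qed.

Lemma borfun_pw (I : countType) (u : baire -> I) (g : I -> baire -> baire) :
  (forall i, bor [set x | u x = i]) -> (forall i, borfun (g i)) ->
  borfun (fun x => g (u x) x).
Proof.
move=> hu hg i k.
exact: (sigma_fun_count bor_sigma hu (fun j => hg j i k)).
Qed.

Lemma borfun_if (P : baire -> Prop) g h : bor [set x | P x] ->
  borfun g -> borfun h -> borfun (fun x => if `[< P x >] then g x else h x).
Proof.
move=> hP hg hh.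
apply: (@borfun_pw _ (fun x => `[< P x >]) (fun b x => if b then g x else h x)).
  case; first by move: hP; congr bor; apply/seteqP; split=> x /asboolP.
  have := sigma_not bor_sigma hP.
  by congr bor; apply/seteqP; split=> x /=; [move/asboolPn/negbTE|move/negbT/asboolPn].
by case.
Qed.

Lemma bor_agree n (p : baire) : bor [set x | agree n p x].
Proof.
apply: (@sigma_all _ _ bor_sigma (fun i x => i < n -> p i = x i)) => i.
apply: (sigma_imp bor_sigma); first exact: (sigma_cst bor_sigma).
have := bor_coord i (p i); congr bor; apply/seteqP; by split=> x /=.
Qed.

(** There are only countably many finite prefixes, so an open set is a countable union of
    cylinders. *)
Lemma bor_open (A : set baire) :
  (forall p, A p -> exists n, forall q, agree n p q -> A q) -> bor A.
Proof.
move=> hA.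
pose W (s : seq nat) : set baire := [set q | agree (size s) (nth 0 s) q /\
  forall r, agree (size s) (nth 0 s) r -> A r].
have : bor [set x | exists s, W s x].
  apply: (@sigma_ex_count _ _ bor_sigma _ W) => s.
  by apply: (sigma_and bor_sigma (bor_agree _ _) (sigma_cst bor_sigma _)).
congr bor; apply/seteqP; split=> x /=; first by case=> s [h1]; apply.
move=> /hA[n hn]; exists (mkseq x n).
by split=> [i|r hr]; [|apply: hn => i]; rewrite ?size_mkseq => iltn;
  [|rewrite -hr ?size_mkseq//]; rewrite nth_mkseq.
Qed.

(* A binary relation on [baire] is represented by the set of the [pr x y]. *)
Definition pr (p q : baire) : baire := fun n => if odd n then q n./2 else p n./2.
Definition pr1 (z : baire) : baire := fun n => z n.*2.
Definition pr2 (z : baire) : baire := fun n => z n.*2.+1.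

Lemma pr1K p q : pr1 (pr p q) = p.
Proof. by apply/funext => n; rewrite /pr1 /pr odd_double doubleK. Qed.

Lemma pr2K p q : pr2 (pr p q) = q.
Proof. by apply/funext => n; rewrite /pr2 /pr/= odd_double/= uphalf_double. Qed.

Lemma borfun_pr f g : borfun f -> borfun g -> borfun (fun x => pr (f x) (g x)).
Proof. by move=> hf hg i k; rewrite /pr; case: (odd i). Qed.

Lemma borfun_pr1 : borfun pr1.
Proof. by move=> i k; apply: bor_coord. Qed.

Lemma borfun_pr2 : borfun pr2.
Proof. by move=> i k; apply: bor_coord. Qed.

(** * Analytic subsets of the Baire space *)

Definition col (i : nat) (z : baire) : baire := fun k => z (pickle (i, k)).

Definition join (s : nat -> baire) : baire :=
  fun n => if unpickle n is Some (i, k) then s i k else 0.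

Lemma col_join s i : col i (join s) = s i.
Proof. by apply/funext => k; rewrite /col /join pickleK. Qed.

Lemma agree_le m n p q : m <= n -> agree n p q -> agree m p q.
Proof. by move=> mn h i im; apply: h; apply: leq_trans mn. Qed.

Lemma agree_sym n p q : agree n p q -> agree n q p.
Proof. by move=> h i /h. Qed.

(** This is closedness in the product topology, so [analytic] means being a projection of a closed
    set. *)
Definition closed2 (F : baire -> baire -> Prop) := forall x y,
  (forall n, exists x' y', [/\ F x' y', agree n x x' & agree n y y']) -> F x y.

Definition analytic (A : set baire) :=
  exists F, closed2 F /\ A = [set x | exists y, F x y].

Lemma analytic_clopen n (A : set baire) :
  (forall p q, agree n p q -> A p -> A q) -> analytic A.
Proof.
move=> hA; exists (fun x _ => A x); split; last first.
  by apply/seteqP; split=> x /=; [exists (fun=> 0)|case].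
by move=> x y /(_ n)[x' [y' [Ax' hx _]]]; apply: hA Ax'; apply: agree_sym.
Qed.

(** Precomposition with [u] is continuous; this is applied to [col], [pr1] and [pr2]. *)
Lemma agree_reindex (u : nat -> nat) n :
  exists N, forall p q, agree N p q -> agree n (p \o u) (q \o u).
Proof.
elim: n => [|n [N hN]]; first by exists 0 => p q _ i.
exists (maxn N (u n).+1) => p q h i; rewrite ltnS leq_eqVlt => /orP[/eqP->|ilt].
  by apply: h; rewrite leq_max leqnn orbT.
by apply: hN ilt; apply: agree_le h; rewrite leq_maxl.
Qed.

(** A single witness holds the witnesses for all [n] as its columns. *)
Lemma analytic_all (A : nat -> set baire) :
  (forall n, analytic (A n)) -> analytic [set x | forall n, A n x].
Proof.
move=> /choice[F hF].
exists (fun x y => forall i, F i x (col i y)); split.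
  move=> x y h i; apply: (proj1 (hF i)) => n.
  have [N hN] := agree_reindex (fun k => pickle (i, k)) n.
  have [x' [y' [hF' hx hy]]] := h (maxn n N); exists x', (col i y').
  split=> //; first by apply: agree_le hx; rewrite leq_maxl.
  by apply: hN; apply: agree_le hy; rewrite leq_maxr.
apply/seteqP; split=> x /=.
  move=> hx.
  have /choice[y hy] n : exists y, F n x y by have := hx n; rewrite (proj2 (hF n)).
  by exists (join y) => i; rewrite col_join.
by case=> y hy n; rewrite (proj2 (hF n)); exists (col n y).
Qed.

(** The first term of the witness names [n]; the remaining terms are a witness for [A n]. *)
Lemma analytic_ex (A : nat -> set baire) :
  (forall n, analytic (A n)) -> analytic [set x | exists n, A n x].
Proof.
move=> /choice[F hF].
exists (fun x y => F (y 0) x (fun k => y k.+1)); split.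
  move=> x y h; apply: (proj1 (hF (y 0))) => n.
  have [x' [y' [hF' hx hy]]] := h n.+1; exists x', (fun k => y' k.+1).
  split.
  - by rewrite hy.
  - exact: agree_le hx.
  - by move=> i ilt; apply: hy.
apply/seteqP; split=> x /=.
  case=> n; rewrite (proj2 (hF n)) => -[y hy].
  by exists (fun k => if k is k'.+1 then y k' else n).
by case=> y hy; exists (y 0); rewrite (proj2 (hF _)); exists (fun k => y k.+1).
Qed.

Lemma agree_pr n x x' y y' :
  agree n x x' -> agree n y y' -> agree n (pr x y) (pr x' y').
Proof.
move=> hx hy i ilt; have i2 : i./2 < n.
  by apply: leq_ltn_trans ilt; rewrite leq_half_double -addnn -addnS leq_addr.
by rewrite /pr; case: odd; [apply: hy|apply: hx].
Qed.

Lemma analytic_proj (A : set baire) :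
  analytic A -> analytic [set x | exists y, A (pr x y)].
Proof.
case=> F [cF ->]; exists (fun x y => F (pr x (pr1 y)) (pr2 y)); split.
  move=> x y h; apply: cF => n.
  have [N1 hN1] := agree_reindex double n.
  have [N2 hN2] := agree_reindex (fun k => k.*2.+1) n.
  have [x' [y' [hF hx hy]]] := h (maxn n (maxn N1 N2)).
  exists (pr x' (pr1 y')), (pr2 y'); split=> //.
    apply: agree_pr; first by apply: agree_le hx; rewrite leq_maxl.
    by apply: hN1; apply: agree_le hy; rewrite !leq_max leqnn orbT.
  by apply: hN2; apply: agree_le hy; rewrite !leq_max leqnn !orbT.
apply/seteqP; split=> x /= [y].
  by case=> w hw; exists (pr y w); rewrite pr1K pr2K.
by move=> h; exists (pr1 y), (pr2 y).
Qed.

(** The sets that are analytic together with their complement form a sigma-algebra, and it contains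
    the clopen generators. *)
Lemma bor_analytic (A : set baire) : bor A -> analytic A.
Proof.
move=> hA; suff: analytic A /\ analytic (~` A) by case.
apply: (@smallest_sub _ _ _ [set A | analytic A /\ analytic (~` A)] _ _ A hA).
  split=> /=.
  - by split; apply: (@analytic_clopen 0).
  - by move=> B [h1 h2]; rewrite setTD setCK.
  - move=> F hF; split.
      have := analytic_ex (fun n => proj1 (hF n)).
      by congr analytic; apply/seteqP; split=> x /= [n]; [|move=> _]; exists n.
    have := analytic_all (fun n => proj2 (hF n)).
    rewrite setC_bigcup; congr analytic; apply/seteqP.
    by split=> x /= h n; have := h n; [|apply].
move=> _ [i [k ->]]; split; apply: (@analytic_clopen i.+1) => p q h /=;
  by rewrite h.
Qed.

(** * Novikov's separation theorem *)

Definition coseparable (A : nat -> set baire) := exists Z : nat -> set baire,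
  [/\ forall n, bor (Z n), forall n, A n `<=` Z n & forall x, ~ forall n, Z n x].

(** Take the union over [v] of the separating sets at [n0] and their intersection elsewhere. Read
    contrapositively: when one member of a family that is not coseparable is cut into countably many
    pieces, some piece keeps the family from being coseparable. *)
Lemma coseparable_split (A : nat -> set baire) (A' : nat -> nat -> set baire) (n0 : nat) :
  (forall v n, n != n0 -> A n `<=` A' v n) ->
  (forall x, A n0 x -> exists v, A' v n0 x) ->
  (forall v, coseparable (A' v)) -> coseparable A.
Proof.
move=> hA hA0 /choice[Z hZ].
exists (fun n => if n == n0 then [set x | exists v, Z v n x] else [set x | forall v, Z v n x]).
split=> [n|n|x h].
- case: eqP => _.
    by apply: (@sigma_ex _ _ bor_sigma (fun v => Z v n)) => v; have [h _ _] := hZ v; exact: h.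
  by apply: (@sigma_all _ _ bor_sigma (fun v => Z v n)) => v; have [h _ _] := hZ v; exact: h.
- case: eqVneq => [->|nn0] x.
    by move=> /hA0[v hv]; exists v; case: (hZ v) => _ + _; apply.
  by move=> Ax v; case: (hZ v) => _ + _; apply; apply: hA Ax.
- have := h n0; rewrite eqxx => -[v hv].
  case: (hZ v) => _ _ /(_ x); apply=> n; have := h n.
  by case: eqVneq => [->|_] //.
Qed.

(** Two members that differ at coordinate [i] are separated by clopen sets; the other members get
    the whole space. *)
Lemma coseparable_disjoint (A : nat -> set baire) (n m : nat) (i a b : nat) :
  a <> b -> n <> m -> (forall x, A n x -> x i = a) -> (forall x, A m x -> x i = b) ->
  coseparable A.
Proof.
move=> ab nm hn hm.
exists (fun k => [set x | (k = n -> x i = a) /\ (k = m -> x i = b)]); split.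
- move=> k; apply: (sigma_and bor_sigma); apply: (sigma_imp bor_sigma);
    by [apply: (sigma_cst bor_sigma)|apply: bor_coord].
- by move=> k x Ax; split=> kE; [apply: hn|apply: hm]; rewrite -kE.
- by move=> x h; apply: ab; rewrite -(proj1 (h n) erefl) -(proj2 (h m) erefl).
Qed.

Lemma coseparable_empty (A : nat -> set baire) n :
  (forall x, ~ A n x) -> coseparable A.
Proof.
move=> h; exists (fun k => [set x | k <> n]); split.
- by move=> k; apply: (sigma_cst bor_sigma).
- by move=> k x Ax /= kn; apply: (h x); rewrite -kn.
- by move=> x /(_ n).
Qed.

(** Dependent choice along finite sequences. *)
Lemma seq_limit (P : seq nat -> Prop) :
  P [::] -> (forall s, P s -> exists v, P (rcons s v)) ->
  exists z : baire, forall n, P (mkseq z n).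
Proof.
move=> P0 PS.
have /choice[g hg] (s : seq nat) : exists v, P s -> P (rcons s v).
  by have [/PS[v hv]|nP] := pselect (P s); [exists v|exists 0].
pose u n := iter n (fun s => rcons s (g s)) [::].
exists (fun n => g (u n)) => n.
have -> : mkseq (fun n => g (u n)) n = u n.
  elim: n => // n IH; rewrite /mkseq -addn1 iotaD map_cat -/(mkseq _ _) IH /= add0n.
  by rewrite addn1 cats1.
by elim: n => //= n /hg.
Qed.

(** If [A] is not coseparable, repeated splitting yields a sequence [z] none of whose prefixes makes
    the restricted family coseparable. Column [n] of [z] codes a point [X n] with a witness, which
    belongs to [F n] by closedness, so [X n] is in [A n]. As the [A n] have no common point, some
    [X n] differs from [X 0] at a coordinate, and a long prefix of [z] then gives a coseparable
    family, a contradiction. *)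
Lemma novikov (A : nat -> set baire) :
  (forall n, analytic (A n)) -> (forall x, ~ forall n, A n x) -> coseparable A.
Proof.
move=> /choice[F hF] A0; apply: contrapT => nsep.
(* The prefix [s] of one global sequence constrains, at its entry of index
   [pickle (n, k)], the [k]-th term of the pair (point, witness) for [A n]. *)
pose As (s : seq nat) (n : nat) : set baire := [set x | exists2 y, F n x y &
  forall k : nat, pickle (n, k) < size s -> pr x y k = nth 0 s (pickle (n, k))].
have [z hz] : exists z : baire, forall t, ~ coseparable (As (mkseq z t)).
  apply: (@seq_limit (fun s => ~ coseparable (As s))).
    move=> h; apply: nsep; case: h => Z [h1 h2 h3]; exists Z; split=> // n x.
    by rewrite (proj2 (hF n)) => -[y hy]; apply: h2; exists y.
  move=> s hs; apply: contrapT => hv; apply: hs.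
  (* The new entry has index [size s], so it cuts only the member named by the decoding of [size s].
     If [size s] codes no pair, the entry constrains nothing and the default 0 is harmless. *)
  apply: (@coseparable_split _ (fun v => As (rcons s v))
     (oapp (fun p : nat * nat => p.1) 0 (unpickle (size s)))).
  - move=> v n nn0 x [y Fy hy]; exists y => // k.
    rewrite size_rcons ltnS leq_eqVlt => /orP[/eqP kE|klt].
      by move: nn0; rewrite -kE pickleK /= eqxx.
    by rewrite nth_rcons klt; apply: hy.
  - set n0 := oapp _ _ _ => x [y Fy hy].
    exists (oapp (fun p : nat * nat => pr x y p.2) 0 (unpickle (size s))).
    exists y => // k; rewrite size_rcons ltnS leq_eqVlt nth_rcons => /orP[/eqP kE|klt].
      by rewrite kE ltnn eqxx -kE pickleK.
    by rewrite klt; apply: hy.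
  - by move=> v; apply: contrapT => h; apply: hv; exists v.
have hbnd (n i : nat) : exists t, forall k : nat, k < i -> pickle (n, k) < t.
  elim: i => [|i [t ht]]; first by exists 0.
  exists (maxn t (pickle (n, i)).+1) => k; rewrite ltnS leq_eqVlt => /orP[/eqP->|/ht kt].
    by rewrite leq_max leqnn orbT.
  by rewrite leq_max kt.
have hne n t : exists x, As (mkseq z t) n x.
  apply: contrapT => h; apply: (hz t); apply: (@coseparable_empty _ n) => x hx.
  by apply: h; exists x.
have hagree (n t : nat) x y i : (forall k : nat, pickle (n, k) < size (mkseq z t) ->
      pr x y k = nth 0 (mkseq z t) (pickle (n, k))) ->
    (forall k, k < i -> pickle (n, k) < t) -> agree i (col n z) (pr x y).
  by move=> h1 h2 k /h2 kt; rewrite h1 ?size_mkseq// nth_mkseq.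
pose X n := pr1 (col n z); pose Y n := pr2 (col n z).
have FXY n : F n (X n) (Y n).
  apply: (proj1 (hF n)) => i.
  have [t ht] := hbnd n i.*2; have [x [y Fy hy]] := hne n t.
  exists x, y; split=> // k ki.
    by rewrite /X /pr1 (hagree _ _ _ _ _ hy ht) ?ltn_double// -[LHS]/(pr1 (pr x y) k) pr1K.
  rewrite /Y /pr2 (hagree _ _ _ _ _ hy ht) -?[LHS]/(pr2 (pr x y) k) ?pr2K//.
  by rewrite -doubleS leq_double.
have [XE|/existsNP[n /existsNP[i hi]]] := pselect (forall n i, X n i = X 0 i).
  apply: (A0 (X 0)) => n; rewrite (proj2 (hF n)); exists (Y n).
  by have := FXY n; congr F; apply/funext.
(* Term [i] of the point is term [i.*2] of the pair, so the prefix must fix the first [i.*2.+1]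
   terms of both pairs. *)
have [t1 ht1] := hbnd n i.*2.+1; have [t2 ht2] := hbnd 0 i.*2.+1.
apply: (hz (maxn t1 t2)).
have aux m x : (forall k, k < i.*2.+1 -> pickle (m, k) < maxn t1 t2) ->
    As (mkseq z (maxn t1 t2)) m x -> x i = X m i.
  move=> hm [y _ hy]; rewrite /X /pr1 (hagree _ _ _ _ _ hy hm)//.
  by rewrite -[RHS]/(pr1 (pr x y) i) pr1K.
apply: (@coseparable_disjoint _ n 0 i (X n i) (X 0 i)) => //.
- by move=> n0; apply: hi; rewrite n0.
- by move=> x; apply: aux => k /ht1 h; rewrite leq_max h.
- by move=> x; apply: aux => k /ht2 h; rewrite leq_max h orbT.
Qed.

Lemma lusin (A B : set baire) : analytic A -> analytic B ->
  (forall x, A x -> ~ B x) -> exists Z, [/\ bor Z, A `<=` Z & forall x, Z x -> ~ B x].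
Proof.
move=> hA hB AB.
have [|x h|Z [Zb ZA Z0]] := @novikov (fun n => if n is 0 then A else B).
- by case.
- exact: (AB x (h 0) (h 1)).
exists (Z 0); split=> // [|x Zx Bx]; first exact: (ZA 0).
by apply: (Z0 x) => -[|n] //; apply: (ZA n.+1).
Qed.

(** * The Lusin-Novikov theorem for finite sections *)

(** For each [(i, k)] the points whose value has [i]-th term [k] and those whose value has another
    [i]-th term form disjoint analytic sets. Borel sets separating them determine the value term by
    term, and [least] extends it to all points. *)
Lemma partial_graph_total (C : set baire) : bor C ->
  (forall x y y', C (pr x y) -> C (pr x y') -> y = y') ->
  exists2 g, borfun g & forall x y, C (pr x y) -> g x = y.
Proof.
move=> bC Cfun.
have hD i (D : set nat) : analytic [set x | exists y, C (pr x y) /\ D (y i)].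
  have : analytic [set z | C z /\ D (pr2 z i)].
    apply: bor_analytic; apply: (sigma_and bor_sigma) => //.
    apply: (@sigma_fun_count _ _ bor_sigma _ (fun z => pr2 z i) (fun k z => D k)).
      by move=> k; apply: borfun_pr2.
    by move=> k; apply: (sigma_cst bor_sigma).
  move=> /analytic_proj; congr analytic; apply/seteqP.
  by split=> x /= [y h]; exists y; move: h; rewrite pr2K.
have /choice[Z hZ] (ik : nat * nat) : exists Z, [/\ bor Z,
    [set x | exists y, C (pr x y) /\ y ik.1 = ik.2] `<=` Z &
    forall x, Z x -> ~ exists y, C (pr x y) /\ y ik.1 <> ik.2].
  apply: lusin; [exact: (hD ik.1 [set ik.2])|exact: (hD ik.1 [set k | k <> ik.2])|].
  by move=> x /= [y [Cy yi]] [y' [/(Cfun _ _ _ Cy) <-]].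
pose g x i := least (fun k => Z (i, k) x).
exists g => [i k|x y Cxy].
  apply: (@sigma_least _ _ (fun k x => Z (i, k) x) _ bor_sigma) => j.
  by have [h _ _] := hZ (i, j); exact: h.
apply/funext => i; have Zy : Z (i, y i) x.
  by have [_ + _] := hZ (i, y i); apply; exists y.
have [Zg _] := leastP (ex_intro (fun k => Z (i, k) x) _ Zy).
have [_ _ /(_ x Zg) h] := hZ (i, g x i).
by apply: contrapT => gy; apply: h; exists y; split=> // e; apply: gy.
Qed.

Lemma finite_bound (T : eqType) (A : set T) (P : T -> nat -> Prop) :
  finite_set A -> (forall x m n, m <= n -> P x m -> P x n) ->
  (forall x, A x -> exists n, P x n) -> exists N, forall x, A x -> P x N.
Proof.
move=> /finite_seqP[s ->] hm; elim: s => [|a s IH] h; first by exists 0.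
have [x xs|N hN] := IH; first by apply: h; rewrite /= inE; apply/orP; right.
have [n hn] : exists n, P a n by apply: h; rewrite /= inE eqxx.
exists (maxn N n) => x /=; rewrite inE => /orP[/eqP->|xs].
  by apply: hm hn; rewrite leq_maxr.
by apply: (hm _ N); [rewrite leq_maxl|apply: hN].
Qed.

Lemma finite_separated (F : set baire) y : finite_set F ->
  exists N, forall y', F y' -> agree N y y' -> y' = y.
Proof.
move=> fF.
have [x m n mn h /(agree_le mn)/h //|x _|N hN] :=
    @finite_bound _ F (fun y' n => agree n y y' -> y' = y) fF; last by exists N.
have [->|/eqP ne] := pselect (x = y); first by exists 0.
have [i hi] : exists i, x i <> y i.
  apply: contrapT => h; move/eqP: ne; apply; apply/funext => i.
  by apply: contrapT => hi; apply: h; exists i.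
by exists i.+1 => /(_ i (ltnSn i)) e; case: hi.
Qed.

(** Since sections are finite, the sets [S n] below have no common point, and Novikov's theorem
    encloses them in Borel sets [Z n] with empty intersection. Outside [Z n] the first [n] terms of
    [y] single it out in its section, so each pair of a length and a prefix gives a partial Borel
    function. Every point of [G] lies outside some [Z n]. *)
Lemma lusin_novikov (G : set baire) : bor G ->
  (forall x, finite_set [set y | G (pr x y)]) ->
  exists g : nat -> baire -> baire, (forall k, borfun (g k)) /\
    forall x y, G (pr x y) -> exists k, y = g k x.
Proof.
move=> bG fG.
(* [S n] is where the first [n] terms do not single out a point of the section. *)
pose S n : set baire := [set z | exists y', [/\ G z, G (pr (pr1 z) y'),
  agree n (pr2 z) y' & y' <> pr2 z]].
have [n|z hz|Z [bZ SZ Z0]] := @novikov S.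
- have : bor [set w | G (pr1 w) /\ (G (pr (pr1 (pr1 w)) (pr2 w)) /\
      (agree n (pr2 (pr1 w)) (pr2 w) /\ ~ (pr2 w = pr2 (pr1 w))))].
    have b1 := borfun_pr1; have b2 := borfun_pr2.
    have b11 := borfun_comp b1 b1; have b21 := borfun_comp b2 b1.
    apply: (sigma_and bor_sigma); first exact: bor_pre.
    apply: (sigma_and bor_sigma); first by apply: bor_pre => //; apply: borfun_pr.
    apply: (sigma_and bor_sigma).
      apply: (@sigma_all _ _ bor_sigma (fun i w => i < n -> pr2 (pr1 w) i = pr2 w i)) => i.
      apply: (sigma_imp bor_sigma); first exact: (sigma_cst bor_sigma).
      exact: (sigma_eq_count bor_sigma (b21 i) (b2 i)).
    by apply: (sigma_not bor_sigma); apply: bor_eqfun.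
  move=> /bor_analytic/analytic_proj; congr analytic; apply/seteqP.
  split=> z /= [y]; first by rewrite pr1K pr2K => -[? [? [? ?]]]; exists y.
  by case=> ? ? ? ?; exists y; rewrite pr1K pr2K.
- have [N hN] := finite_separated (pr2 z) (fG (pr1 z)).
  by have [y' [_ Gy' /(hN _ Gy')]] := hz N.
have hC (ns : nat * seq nat) : exists g, borfun g /\ forall x y, G (pr x y) ->
    ~ Z ns.1 (pr x y) -> agree ns.1 (nth 0 ns.2) y -> g x = y.
  have [||g bg hg] := @partial_graph_total [set z | G z /\ (~ Z ns.1 z /\
      agree ns.1 (nth 0 ns.2) (pr2 z))].
  - apply: (sigma_and bor_sigma) => //; apply: (sigma_and bor_sigma).
      by apply: (sigma_not bor_sigma); apply: bZ.
    by apply: (bor_pre borfun_pr2 (bor_agree _ _)).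
  - move=> x y y' [Gy [nZ]]; rewrite pr2K => ay [Gy' [_]]; rewrite pr2K => ay'.
    apply: contrapT => yy'; apply: nZ; apply: SZ; exists y'; rewrite pr1K pr2K.
    by split=> // [i ilt|/esym//]; rewrite -ay ?ay'.
  - by exists g; split=> // x y Gy nZ ay; apply: hg; rewrite /= pr2K.
move: hC => /choice[g hg].
exists (fun k => if unpickle k is Some ns then g ns else id); split=> [k|x y Gxy].
  by case: unpickle => [ns|]; [case: (hg ns)|apply: borfun_id].
have [n nZ] : exists n, ~ Z n (pr x y).
  by apply: contrapT => h; apply: (Z0 (pr x y)) => n; apply: contrapT => hn; apply: h; exists n.
exists (pickle (n, mkseq y n)); rewrite pickleK; apply/esym.
case: (hg (n, mkseq y n)) => _; apply=> // i ilt; by rewrite nth_mkseq.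
Qed.

Lemma lusin_novikov_seq (G : nat -> set baire) : (forall n, bor (G n)) ->
  (forall n x, finite_set [set y | G n (pr x y)]) ->
  exists g : nat -> baire -> baire, (forall k, borfun (g k)) /\
    forall n x y, G n (pr x y) -> exists k, y = g k x.
Proof.
move=> bG fG; have /choice[g hg] n := lusin_novikov (bG n) (fG n).
exists (fun k => if unpickle k is Some (n, j) then g n j else id); split=> [k|n x y Gxy].
  by case: unpickle => [[n j]|]; [case: (hg n)|apply: borfun_id].
have [j ->] : exists j, y = g n j x by case: (hg n) => _; apply.
by exists (pickle (n, j)); rewrite pickleK.
Qed.

(** * The reduction to eventual equality, on the Baire space *)

Section Core.
Context (G : nat -> set baire) (bG : forall n, bor (G n))
  (Grefl : forall n x, G n (pr x x))
  (Gsym : forall n x y, G n (pr x y) -> G n (pr y x))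
  (Gincr : forall n, G n `<=` G n.+1)
  (Gfin : forall n x, finite_set [set y | G n (pr x y)])
  (Gtrans : forall n m x y z, G n (pr x y) -> G m (pr y z) ->
    exists k, G k (pr x z)).

Lemma graph_le n m : n <= m -> G n `<=` G m.
Proof.
elim: m => [|m IH]; first by rewrite leqn0 => /eqP->.
by rewrite leq_eqVlt ltnS => /orP[/eqP->//|/IH h] z /h; apply: Gincr.
Qed.

(** Walks have length exactly [k], but since [G n] contains all loops this amounts to distance at
    most [k]. *)
Fixpoint reach (n k : nat) (x y : baire) : Prop :=
  if k is k'.+1 then exists z, reach n k' x z /\ G n (pr z y) else x = y.

Lemma reach_trans n k l x y z : reach n k x y -> reach n l y z -> reach n (k + l) x z.
Proof.
move=> xy; elim: l z => [z <-|l IH z /= [w [yw wz]]]; first by rewrite addn0.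
by rewrite addnS; exists w; split=> //; apply: IH.
Qed.

Lemma reach1 n x y : G n (pr x y) -> reach n 1 x y.
Proof. by exists x. Qed.

Lemma reach_sym n k x y : reach n k x y -> reach n k y x.
Proof.
elim: k y => [y ->//|k IH y /= [z [/IH xz /Gsym/reach1 zy]]].
by have := reach_trans zy xz; rewrite add1n.
Qed.

Lemma reach_le n m k l x y : n <= m -> k <= l -> reach n k x y -> reach m l x y.
Proof.
move=> nm kl h; have {kl} : reach n l x y.
  elim: l kl => [|l IH]; first by rewrite leqn0 => /eqP <-.
  by rewrite leq_eqVlt ltnS => /orP[/eqP<-//|/IH h']; exists y.
elim: l y {h} => //= l IH y [z [/IH xz /(graph_le nm) zy]].
by exists z.
Qed.

Lemma reach_rel n k x y : reach n k x y -> exists m, G m (pr x y).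
Proof.
elim: k y => [y ->|k IH y /= [z [/IH[m xz] zy]]]; first by exists 0.
exact: Gtrans xz zy.
Qed.

Lemma finite_reach n k x : finite_set [set y | reach n k x y].
Proof.
elim: k => [|k IH] /=.
  by apply: sub_finite_set (finite_set1 x) => y /= ->.
apply: (sub_finite_set _ (bigcup_finite IH (fun z _ => @Gfin n z))).
by move=> y /= [z [? ?]]; exists z.
Qed.

Context (g : nat -> baire -> baire) (bg : forall k, borfun (g k))
  (gG : forall n x y, G n (pr x y) -> exists k, y = g k x).

(** The intermediate vertex is related to the first one, hence is among its images under the [g j];
    the quantifier over vertices becomes countable. *)
Lemma bor_reach n k : bor [set z | reach n k (pr1 z) (pr2 z)].
Proof.
have b1 := borfun_pr1; have b2 := borfun_pr2.
elim: k => [|k IH] /=; first exact: bor_eqfun.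
have : bor [set z | exists j, reach n k (pr1 z) (g j (pr1 z)) /\
    G n (pr (g j (pr1 z)) (pr2 z))].
  apply: (@sigma_ex _ _ bor_sigma (fun j z => reach n k (pr1 z) (g j (pr1 z)) /\
    G n (pr (g j (pr1 z)) (pr2 z)))) => j.
  have bj := borfun_comp (bg j) b1.
  apply: (sigma_and bor_sigma); last by apply: bor_pre => //; apply: borfun_pr.
  have := bor_pre (borfun_pr b1 bj) IH.
  by congr bor; apply/seteqP; split=> z /=; rewrite pr1K pr2K.
congr bor; apply/seteqP; split=> z /=; first by case=> j h; exists (g j (pr1 z)).
move=> [w [zw wz]]; have [m /gG[j wE]] := reach_rel zw.
by exists j; rewrite -wE.
Qed.

Context (f : nat -> nat) (hf : forall n, (2 * (f n + 1) <= f n.+1)%N)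
  (B : nat -> set baire) (bB : forall n, bor (B n))
  (Bsep : forall n x y, B n x -> B n y -> reach n (f n) x y -> x = y).

(** [r n] bounds how far [h n] moves points, and [s n] how far [p n] does. *)
Let r n := (f n)./2.
Let s n := \sum_(i < n) r i.

(** The growth of [f] gives [2 * r n + 1 <= r n.+1], and induction applies. The strict inequality
    leaves room for one more edge in [p_capture]. *)
Lemma sum_half_lt n : s n.+1 < r n.+1.
Proof.
have sS k : s k.+1 = s k + r k by rewrite /s big_ord_recr.
elim: n => [|n IH]; rewrite sS.
  by rewrite /s big_ord0 /r; have := hf 0; lia.
by have := hf n.+1; move: IH; rewrite /r; lia.
Qed.

Let near n x y := B n y /\ reach n (r n) x y.

(** Two walks of length [r n] join into one of length at most [f n], within the range of the
    separation of [B n]. *)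
Lemma near_uniq n x y z : near n x y -> near n x z -> y = z.
Proof.
move=> [By xy] [Bz xz]; apply: Bsep By Bz _.
by apply: reach_le (reach_trans (reach_sym xy) xz) => //; rewrite /r; lia.
Qed.

(* Moves [x] to the unique point of [B n] within distance [f n / 2], if any. *)
Let h n x : baire :=
  let k := least (fun k => near n x (g k x)) in
  if `[< near n x (g k x) >] then g k x else x.

Lemma hE n x y : near n x y -> h n x = y.
Proof.
move=> xy; have [m /gG[k yE]] := reach_rel (proj2 xy).
have [hk _] := @leastP (fun k => near n x (g k x)) (ex_intro _ k (eq_ind y (near n x) xy _ yE)).
by rewrite /h asboolT//; apply: near_uniq xy.
Qed.

Lemma bor_near n u : borfun u -> bor [set x | near n x (u x)].
Proof.
move=> bu; apply: (sigma_and bor_sigma); first exact: bor_pre.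
have := bor_pre (borfun_pr borfun_id bu) (@bor_reach n (r n)).
by congr bor; apply/seteqP; split=> z /=; rewrite pr1K pr2K.
Qed.

Lemma borfun_h n : borfun (h n).
Proof.
have bu : borfun (fun x => g (least (fun k => near n x (g k x))) x).
  apply: (@borfun_pw _ (fun x => least (fun k => near n x (g k x))) g) => // i.
  by apply: (@sigma_least _ _ (fun k x => near n x (g k x)) _ bor_sigma) => j; apply: bor_near.
apply: borfun_if => //; [exact: bor_near|exact: borfun_id].
Qed.

Lemma reach_h n x : reach n (r n) x (h n x).
Proof.
rewrite /h; case: asboolP => [[]//|_].
by apply: (@reach_le n n 0 (r n) x x).
Qed.

Let p := fix p n x := if n is n'.+1 then h n' (p n' x) else x.

Lemma borfun_p n : borfun (p n).
Proof.
by elim: n => [|n IH]; [apply: borfun_id|exact: (borfun_comp (@borfun_h n) IH)].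
Qed.

Lemma reach_p n x : reach n (s n) x (p n x).
Proof.
elim: n => [|n IH]; first by rewrite /s big_ord0.
rewrite /s big_ord_recr /=; apply: (@reach_le n n.+1 _ _ _ _ (leqnSn n) (leqnn _)).
exact: reach_trans IH (reach_h _ _).
Qed.

Lemma p_le n m x y : n <= m -> p n x = p n y -> p m x = p m y.
Proof.
move=> + e; elim: m => [|m IH]; first by rewrite leqn0 => /eqP<-.
by rewrite leq_eqVlt ltnS => /orP[/eqP<-//|/IH /= ->].
Qed.

Lemma p_rel n x y : p n x = p n y -> exists m, G m (pr x y).
Proof.
move=> e; have := reach_p n y; rewrite -e => /reach_sym.
by move=> /(reach_trans (reach_p n x))/reach_rel.
Qed.

(** Both [p n.+1 x] and [p n.+1 y] are at distance at most [s n.+1 + 1] from [x], hence at most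
    [r n.+1], so [h n.+1] sends both to [x]. *)
Lemma p_capture n x y : B n.+1 x -> G n.+1 (pr x y) -> p n.+2 x = p n.+2 y.
Proof.
move=> Bx xy; have sr := sum_half_lt n.
have nearx z : reach n.+1 1 z x -> near n.+1 (p n.+1 z) x.
  move=> zx; split=> //.
  apply: reach_le (reach_trans (reach_sym (reach_p n.+1 z)) zx) => //.
  by rewrite addn1.
rewrite -[LHS]/(h n.+1 (p n.+1 x)) -[RHS]/(h n.+1 (p n.+1 y)).
rewrite (hE (nearx x _)) ?(hE (nearx y _))//; first exact/reach1/Gsym.
exact/reach1.
Qed.

(** A label that recovers [p n x] from [p n.+1 x]. *)
Let idx n x := least (fun k => p n x = g k (p n.+1 x)).

Lemma idxP n x : p n x = g (idx n x) (p n.+1 x).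
Proof.
have [m /gG[k xk]] := reach_rel (reach_sym (reach_h n (p n x))).
by have [] := @leastP (fun k => p n x = g k (p n.+1 x)) (ex_intro _ k xk).
Qed.

Lemma bor_idx n k : bor [set x | idx n x = k].
Proof.
apply: (@sigma_least _ _ (fun k x => p n x = g k (p n.+1 x)) _ bor_sigma) => j.
by apply: bor_eqfun; [apply: borfun_p|exact: (borfun_comp (bg j) (@borfun_p n.+1))].
Qed.

(** The coordinates approximate [x]; the labels let [event_inj] descend from [p n] to [p N]. *)
Let key n x : seq (nat * nat) := mkseq (fun i => (idx i x, x i)) n.

Lemma bor_key n c : bor [set x | key n x = c].
Proof.
elim: n c => [|n IH] c; first exact: (sigma_cst bor_sigma ([::] = c)).
have : bor [set x | exists t : seq (nat * nat) * nat * nat,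
    c = rcons t.1.1 (t.1.2, t.2) /\ (key n x = t.1.1 /\ (idx n x = t.1.2 /\ x n = t.2))].
  apply: (@sigma_ex_count _ _ bor_sigma _ (fun t x =>
    c = rcons t.1.1 (t.1.2, t.2) /\ (key n x = t.1.1 /\ (idx n x = t.1.2 /\ x n = t.2)))) => t.
  apply: (sigma_and bor_sigma (sigma_cst bor_sigma _)).
  apply: (sigma_and bor_sigma (IH _)); apply: (sigma_and bor_sigma (bor_idx _ _)).
  exact: bor_coord.
have keyS x : key n.+1 x = rcons (key n x) (idx n x, x n).
  by rewrite /key /mkseq -addn1 iotaD map_cat cats1.
congr bor; apply/seteqP; split=> x /=; rewrite keyS.
  by case=> -[[t a] b] [-> [-> [-> ->]]].
by move=> <-; exists (key n x, idx n x, x n).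
Qed.

Lemma finite_fiber n q : finite_set [set w | p n w = q].
Proof.
apply: (sub_finite_set _ (@finite_reach n (s n) q)) => w /= <-.
exact/reach_sym/reach_p.
Qed.

(* The kernels of the maps [p n] increase. An event records the way back from
   [p n.+1 x] to [p n x] together with one approximation of the fibre of [p n]
   over [p n x]: it depends only on [p n x], finitely many occur at each level,
   and all events from some level on determine [p n x]. *)
Let event n k c x := idx n x = k /\ exists w, p n w = p n x /\ key n w = c.

Lemma event_eq n m k c x y : n <= m -> p n x = p n y -> event m k c x -> event m k c y.
Proof.
move=> nm e [ik [w [wx wc]]]; have em := p_le nm e; split.
  by rewrite -ik /idx em (p_le (leqW nm) e).
by exists w; rewrite -em.
Qed.

Lemma bor_event n k c : bor [set x | event n k c x].
Proof.
apply: (sigma_and bor_sigma (bor_idx _ _)).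
have : bor [set x | exists j, p n (g j x) = p n x /\ key n (g j x) = c].
  apply: (@sigma_ex _ _ bor_sigma (fun j x => p n (g j x) = p n x /\ key n (g j x) = c)) => j.
  apply: (sigma_and bor_sigma); last exact: (bor_pre (bg j) (bor_key n c)).
  by apply: bor_eqfun; [exact: (borfun_comp (@borfun_p n) (bg j))|apply: borfun_p].
congr bor; apply/seteqP; split=> x /=; first by case=> j; exists (g j x).
by case=> w [wx wc]; have [m /gG[j wE]] := p_rel (esym wx); exists j; rewrite -wE.
Qed.

Lemma event_bounded N x : exists M, forall n k c, n < N -> event n k c x ->
  pickle (n, k, c) < M.
Proof.
have [n m1 m2 m12 h1 k c /h1 lt|n _|M hM] := @finite_bound _ `I_N
  (fun n M => forall k c, event n k c x -> pickle (n, k, c) < M) (finite_II N).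
- exact: leq_trans lt m12.
- have [w m1 m2 m12 h1|w _|M hM] := @finite_bound _ [set w | p n w = p n x]
    (fun w M => pickle (n, idx n x, key n w) < M) (finite_fiber n (p n x)).
  + exact: leq_trans h1 m12.
  + by exists (pickle (n, idx n x, key n w)).+1.
  + by exists M => k c [<- [w [wx <-]]]; apply: hM.
- by exists M => n k c nN; apply: hM.
Qed.

(** The hypothesis makes the labels of [x] and [y] equal from [N] on. For large [n], the event of
    [x] with its own key is one of [y], which gives [w] with [p n w = p n y] and the key of [x].
    Descending along the common labels, [p N w = p N y]; as [w] agrees with [x] on a long prefix and
    the fibre is finite, [w = x]. *)
Lemma event_inj N x y : (forall n k c, N <= n -> event n k c x -> event n k c y) ->
  p N x = p N y.
Proof.
move=> hev.
have hidx n : N <= n -> idx n x = idx n y.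
  by move=> Nn; have [|<-] := hev n (idx n x) (key n x) Nn; first by split=> //; exists x.
suff : [set w | p N w = p N y] x by [].
(* The prefix length is chosen for [x] before [x] is known to lie in this fibre. *)
have [M hM] := finite_separated x (finite_fiber N (p N y)).
set n := maxn N M; have Nn : N <= n by rewrite leq_maxl.
have [|_ [w [wy wx]]] := hev n (idx n x) (key n x) Nn; first by split=> //; exists x.
have hw i : i < n -> (idx i w, w i) = (idx i x, x i).
  move=> ilt; have := congr1 (fun c => nth (0, 0) c i) wx.
  by rewrite !nth_mkseq.
have wN : p N w = p N y.
  have : forall j, N <= n - j -> p (n - j) w = p (n - j) y.
    elim=> [|j IH] Nj; first by rewrite subn0.
    have [nj|nj] := leqP n j.
      have ej : n - j.+1 = n - j by lia.
      by rewrite ej in Nj *; apply: IH.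
    have e : (n - j.+1).+1 = n - j by lia.
    rewrite idxP [RHS]idxP e IH ?(leq_trans Nj)//; last by lia.
    have /hw[-> _] : n - j.+1 < n by lia.
    by rewrite hidx.
  by move=> /(_ (n - N)); rewrite subKn//; apply.
rewrite -[x](hM w)// => i iM; have /hw[_ ->//] : i < n.
by rewrite (leq_trans iM)// leq_maxr.
Qed.

Theorem hyperfinite_core : exists Phi : baire -> nat -> Prop,
  (forall m, bor [set x | Phi x m]) /\
  forall x y, (forall N, exists2 n, N <= n & B n x) ->
    ((exists n, G n (pr x y)) <->
     exists M, forall m, M <= m -> (Phi x m <-> Phi y m)).
Proof.
(* With [pickle_inv], an index decodes to an event only if it is the code of that event, so
   [event_bounded] controls all indices of low level. *)
exists (fun x m => if pickle_inv m is Some (n, k, c) then event n k c x else False).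
split=> [m|x y infx].
  by case: pickle_inv => [[[n k] c]|]; [apply: bor_event|apply: (sigma_cst bor_sigma)].
split.
  (* Asking for an index at least [n.+1] makes it a successor, as [p_capture] requires. From level
     [m.+2] on the events of [x] and [y] coincide, and those of lower level have bounded codes. *)
  move=> [n nxy]; have [[|m] // nm Bx] := infx n.+1.
  have e := p_capture Bx (graph_le (ltnW nm) nxy).
  have [M1 hM1] := event_bounded m.+2 x; have [M2 hM2] := event_bounded m.+2 y.
  exists (maxn M1 M2) => i; rewrite geq_max => /andP[i1 i2].
  case E: (pickle_inv i) => [[[n' k] c]|//].
  have iE : pickle (n', k, c) = i.
    by have := @pickle_invK (nat * nat * seq (nat * nat))%type i; rewrite E.
  have [lt|ge] := ltnP n' m.+2.
    by split=> [/(hM1 _ _ _ lt)|/(hM2 _ _ _ lt)]; rewrite iE ltnNge ?i1 ?i2.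
  by split; apply: event_eq ge _.
move=> [M hM].
(* [N] exceeds the level of every event with code below [M], so all events from level [N] on are
   compared by [hM]. *)
have [i n1 n2 n12 h1 n k c e|i _|N hN] := @finite_bound _ `I_M
  (fun i N => forall (n k : nat) (c : seq (nat * nat)),
    pickle_inv i = Some (n, k, c) -> n < N) (finite_II M).
- exact: leq_trans (h1 _ _ _ e) n12.
- case: pickle_inv => [[[n k] c]|]; last by exists 0.
  by exists n.+1 => _ _ _ [<- _ _].
apply: (@p_rel N); apply: event_inj => n k c Nn ev.
have Mn : M <= pickle (n, k, c).
  rewrite leqNgt; apply/negP => lt.
  by have := hN _ lt n k c; rewrite pickleK_inv ltnNge Nn => /(_ erefl).
by have := hM _ Mn; rewrite pickleK_inv => -[+ _]; apply.
Qed.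

End Core.

(** * Borel maps into the Cantor space, and restrictions *)

Lemma borel_sigma (T : topologicalType) : sigma_algebra setT (@borel T).
Proof. exact: smallest_sigma_algebra. Qed.

Lemma open_borel (T : topologicalType) (U : set T) : open U -> borel U.
Proof. exact: sub_sigma_algebra. Qed.

Lemma borel_map_continuous (T U : topologicalType) (phi : T -> U) :
  continuous phi -> borel_map phi.
Proof.
move=> /continuousP cphi; apply: (sigma_preimage (borel_sigma T)) => A oA.
by apply: open_borel; apply: cphi.
Qed.

(** The filter generated by the cylinders around [u] converges to [u] coordinatewise, hence in the
    product topology. *)
Lemma cantor_open (U : set cantor_space) u : open U -> U u ->
  exists n, forall v : cantor_space, (forall i, i < n -> v i = u i) -> U v.
Proof.
move=> oU Uu.
pose F : set_system cantor_space :=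
  [set A | exists n, forall v : cantor_space, (forall i, i < n -> v i = u i) -> A v].
have FF : Filter F.
  split; first by exists 0.
  - move=> A A' [n hn] [m hm]; exists (maxn n m) => v hv; split.
      by apply: hn => i ilt; apply: hv; rewrite leq_max ilt.
    by apply: hm => i ilt; apply: hv; rewrite leq_max ilt orbT.
  - by move=> A A' AA' [n hn]; exists n => v /hn; apply: AA'.
suff : F --> u by apply; apply: open_nbhs_nbhs.
apply/cvg_sup => i A; rewrite nbhsE.
case=> V [[V' _ <-] V'u] VA.
exists i.+1 => v hv; apply: VA; by rewrite /preimage /= hv.
Qed.

Lemma borel_map_cantor (T : topologicalType) (phi : T -> cantor_space) :
  (forall i, borel [set x | phi x i]) -> borel_map phi.
Proof.
move=> hphi; apply: (sigma_preimage (borel_sigma T)) => U oU.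
have hc i b : borel [set x | phi x i = b].
  case: b; first exact: hphi.
  have := sigma_not (borel_sigma T) (hphi i).
  by congr borel; apply/seteqP; split=> x /=; [move/negP/negbTE|move=> ->].
pose W (s : seq bool) x := (forall i, i < size s -> phi x i = nth false s i) /\
  (forall v : cantor_space, (forall i, i < size s -> v i = nth false s i) -> U v).
have : borel [set x | exists s, W s x].
  apply: (sigma_ex_count (borel_sigma T)) => s.
  apply: (sigma_and (borel_sigma T)); last exact: (sigma_cst (borel_sigma T)).
  apply: (@sigma_all _ _ (borel_sigma T)
    (fun i x => i < size s -> phi x i = nth false s i)) => i.
  by apply: (sigma_imp (borel_sigma T)) => //; exact: (sigma_cst (borel_sigma T)).
congr borel; apply/seteqP; split=> x /=; first by case=> s [h1]; apply.
move=> /(cantor_open oU)[n hn]; exists (mkseq (phi x) n).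
by split=> [i|v hv]; [|apply: hn => i]; rewrite ?size_mkseq => iltn;
  [|rewrite hv ?size_mkseq//]; rewrite nth_mkseq.
Qed.

Lemma continuous_set_val (T : topologicalType) (Y : set T) :
  continuous (@set_val T Y).
Proof. exact: initial_continuous. Qed.

Lemma cber_restriction (T : topologicalType) (E : set (T * T)) (Y : set T) :
  cber E -> cber (restriction E Y).
Proof.
move=> [[Er Es Et] bE cE]; split.
- split=> [x|x y|x y z]; [exact: Er|exact: Es|exact: Et].
- have : borel_map (fun p : set_type Y * set_type Y => (set_val p.1, set_val p.2)).
    apply: borel_map_continuous => p; apply: cvg_pair.
      by apply: (@cvg_comp _ _ _ fst (@set_val T Y));
        [exact: cvg_fst|exact: continuous_set_val].
    by apply: (@cvg_comp _ _ _ snd (@set_val T Y));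
      [exact: cvg_snd|exact: continuous_set_val].
  by move=> /(_ _ bE).
- move=> x; apply: (@card_le_trans _ _ _ [set y | E (set_val x, y)]); last exact: cE.
  apply: (@card_ge_preimage _ _ [set y | E (set_val x, y)] (@set_val T Y)).
  by move=> a b _ _ /val_inj.
Qed.

(** Covers an empty [X], where the coding has no base point. *)
Lemma hyperfinite_empty (T : topologicalType) (E : set (T * T)) :
  (T -> False) -> cber E -> hyperfinite E.
Proof.
move=> T0 cE; split=> //; exists (fun x => False_rect _ (T0 x)); split=> [A _|x].
  rewrite (_ : _ @^-1` _ = set0); first by case: (borel_sigma T).
  by apply/seteqP; split=> x.
by case: (T0 x).
Qed.

Lemma infinite_setE (A : set nat) :
  infinite_set A <-> forall N, exists2 n, N <= n & A n.
Proof.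
split=> [iA N|h /finite_seqP[s sE]].
  apply: contrapT => h; apply: iA; apply: (sub_finite_set _ (finite_II N)) => n An /=.
  by rewrite ltnNge; apply/negP => Nn; apply: h; exists n.
have [n lt] := h (\max_(i <- s) i).+1; rewrite sE /= => ns.
by move: lt; rewrite ltnNge (leq_bigmax_seq (F := fun i => i)).
Qed.

(** * Coding a nonempty Polish space by a Borel subset of the Baire space *)

Section Coding.
Local Open Scope ring_scope.
Context (R : realType) (X : topologicalType) (d : X -> X -> R)
  (d_metric : is_metric d) (dX : metrizes d) (d_complete : complete_metric d)
  (e : nat -> X) (e_dense : forall x r, 0 < r -> exists i, d x (e i) < r) (x0 : X).

Let eps (n : nat) : R := n.+1%:R^-1.

Lemma eps_gt0 n : 0 < eps n.
Proof. by rewrite invr_gt0 ltr0n. Qed.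

Lemma eps_small r : 0 < r -> exists n, eps n < r.
Proof. by move=> /ltr_add_invr[n]; rewrite add0r; exists n. Qed.

Lemma eps_le m n : (m <= n)%N -> eps n <= eps m.
Proof. by move=> mn; rewrite lef_pV2 ?posrE ?ltr0n// ler_nat ltnS. Qed.

Let dC x y : d x y = d y x. Proof. by case: d_metric. Qed.
Let dT x y z : d x z <= d x y + d y z. Proof. by case: d_metric. Qed.

Lemma metric_small_eq x y : (forall r, 0 < r -> d x y < r) -> x = y.
Proof.
move=> h; case: d_metric => d0 dE _ _; apply/dE/eqP.
rewrite eq_le d0 andbT leNgt; apply/negP => /[dup] dxy /h.
by rewrite ltxx.
Qed.

Lemma open_metric_ball x r : open [set y | d x y < r].
Proof.
apply/dX => y /= xy; exists (r - d x y); first by rewrite subr_gt0.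
move=> z /= yz; apply: le_lt_trans (dT x y z) _.
by move: yz; rewrite /metric_ball /= ltrBrDl.
Qed.

Let code (x : X) : baire := fun n => least (fun i => d x (e i) < eps n).

Lemma codeP x n : d x (e (code x n)) < eps n.
Proof. by case: (leastP (e_dense x (eps_gt0 n))). Qed.

Lemma borel_code n k : borel [set x | code x n = k].
Proof.
apply: (@sigma_least _ _ (fun i x => d x (e i) < eps n) _ (borel_sigma X)) => i.
apply: open_borel; have := open_metric_ball (e i) (eps n).
by congr open; apply/seteqP; split=> x /=; rewrite dC.
Qed.

Lemma bor_preimage_code A : bor A -> borel (code @^-1` A).
Proof.
by apply: (sigma_preimage (borel_sigma X)) => _ [n [k ->]]; apply: borel_code.
Qed.

(** The inequality is not strict so that it survives the limit in [codes_dec]. [Q] expresses through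
    [p] alone that [p] codes some point. *)
Let codes (p : baire) x := forall n, d x (e (p n)) <= eps n.
Let Q (p : baire) := forall n m, d (e (p n)) (e (p m)) <= eps n + eps m.
Let dec (p : baire) : X :=
  if pselect (exists x, codes p x) is left h then projT1 (cid h) else x0.

(** This serves both for the uniqueness of the coded point and for the continuity of [dec] on
    [Q]. *)
Lemma codes_uniq p q x y : codes p x -> codes q y -> forall n, p n = q n ->
  d x y <= eps n + eps n.
Proof.
move=> px qy n pq; apply: le_trans (dT x (e (p n)) y) _.
by apply: lerD; rewrite ?px// pq dC.
Qed.

Lemma eps2_small r : 0 < r -> exists n, eps n + eps n < r.
Proof.
move=> r0; have /eps_small[n hn] : 0 < r / 2 by rewrite divr_gt0.
by exists n; rewrite [r]splitr ltrD.
Qed.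

Lemma codes_inj p x y : codes p x -> codes p y -> x = y.
Proof.
move=> px py; apply: metric_small_eq => r /eps2_small[n]; apply: le_lt_trans.
exact: (codes_uniq px py).
Qed.

Lemma decE p x : codes p x -> dec p = x.
Proof.
move=> px; rewrite /dec; case: pselect => [h|[]]; last by exists x.
by case: cid => y /= py; apply: codes_inj py px.
Qed.

Lemma codes_code x : codes (code x) x.
Proof. by move=> n; apply/ltW/codeP. Qed.

Lemma codeK x : dec (code x) = x.
Proof. exact: decE (codes_code x). Qed.

(** [Q] makes the sequence of the [e (p n)] Cauchy, and letting one index of [Q] tend to infinity
    bounds the distance from its limit to [e (p n)]. *)
Lemma codes_dec p : Q p -> codes p (dec p).
Proof.
move=> Qp; suff [x px] : exists x, codes p x by rewrite (decE px).
have [r r0|l hl] := d_complete (u := fun n => e (p n)).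
  have [n hn] := eps2_small r0; exists n => i j ni nj.
  apply: le_lt_trans (Qp i j) _; apply: le_lt_trans hn.
  by apply: lerD; apply: eps_le.
exists l => n; apply/ler_addgt0Pr => r r0.
have /hl[N hN] : 0 < r / 2 by rewrite divr_gt0.
have [m hm] : exists m, eps m < r / 2 by apply: eps_small; rewrite divr_gt0.
pose k := maxn N m.
apply: le_trans (dT l (e (p k)) (e (p n))) _.
have h1 : d l (e (p k)) <= r / 2 by rewrite dC ltW// hN// leq_maxl.
have h2 : eps k <= r / 2 by apply: le_trans (ltW hm); rewrite eps_le// leq_maxr.
rewrite [r]splitr addrCA; apply: lerD => //; apply: le_trans (Qp k n) _.
by rewrite [eps k + _]addrC lerD2l.
Qed.

Lemma Q_code x : Q (code x).
Proof.
move=> n m; apply: le_trans (dT _ x _) _.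
by rewrite dC; apply: lerD; apply: codes_code.
Qed.

Lemma bor_Q : bor [set p | Q p].
Proof.
apply: (@sigma_all _ _ bor_sigma
  (fun n p => forall m, d (e (p n)) (e (p m)) <= eps n + eps m)) => n.
apply: (@sigma_all _ _ bor_sigma (fun m p => d (e (p n)) (e (p m)) <= eps n + eps m)) => m.
apply: (@sigma_fun_count _ _ bor_sigma _ (fun p => p n)
  (fun i p => d (e i) (e (p m)) <= eps n + eps m)).
  by move=> i; apply: bor_coord.
move=> i; apply: (@sigma_fun_count _ _ bor_sigma _ (fun p => p m)
  (fun j p => d (e i) (e j) <= eps n + eps m)).
  by move=> j; apply: bor_coord.
by move=> j; apply: (sigma_cst bor_sigma).
Qed.

(* Replaces the sequences outside [Q], where [dec] is junk, by a code of [x0]. *)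
Let retract (p : baire) : baire := if `[< Q p >] then p else code x0.

Lemma borfun_retract : borfun retract.
Proof.
apply: borfun_if bor_Q borfun_id _ => i k; exact: (sigma_cst bor_sigma).
Qed.

Lemma Q_retract p : Q (retract p).
Proof. by rewrite /retract; case: asboolP => // _; apply: Q_code. Qed.

Lemma dec_retract p : dec (retract p) = dec p.
Proof.
rewrite /retract; case: asboolP => // nQ; rewrite codeK /dec.
case: pselect => // -[x px]; case: nQ => n m.
apply: le_trans (dT _ x _) _; rewrite dC; exact: lerD.
Qed.

Lemma ball_nbhs x (A : set X) : nbhs x A ->
  exists2 r, 0 < r & forall y, d x y < r -> A y.
Proof.
rewrite nbhsE => -[U [oU Ux] UA]; have [/(_ oU x Ux)[r r0 hr] _] := dX U.
by exists r => // y /hr/UA.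
Qed.

(** On pairs from [Q] the map is continuous, so the preimage of an open [A] is there the trace of an
    open set [W]. Composing with [retract], which does not change [dec], extends this to all
    pairs. *)
Lemma bor_dec2 (A : set (X * X)) : borel A ->
  bor [set z | A (dec (pr1 z), dec (pr2 z))].
Proof.
apply: (@sigma_preimage _ _ bor _ (fun z => (dec (pr1 z), dec (pr2 z))) bor_sigma).
move=> {}A oA.
pose W : set baire := [set z | exists n, forall z', agree n z z' ->
  Q (pr1 z') -> Q (pr2 z') -> A (dec (pr1 z'), dec (pr2 z'))].
have bW : bor W.
  apply: bor_open => z [n hn]; exists n => z' zz'; exists n => z'' z'z''.
  by apply: hn => i ilt; rewrite zz' ?z'z''.
have br1 := borfun_comp borfun_retract borfun_pr1.
have br2 := borfun_comp borfun_retract borfun_pr2.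
have := bor_pre (borfun_pr br1 br2) bW.
congr bor; apply/seteqP; split=> z /=.
  case=> n /(_ _ (fun i _ => erefl)); rewrite pr1K pr2K !dec_retract.
  by apply; apply: Q_retract.
rewrite -(dec_retract (pr1 z)) -(dec_retract (pr2 z)).
set p := retract (pr1 z); set q := retract (pr2 z) => Apq.
have [Qp Qq] : Q p /\ Q q by split; apply: Q_retract.
have [[U V] /= [/ball_nbhs[r r0 rU] /ball_nbhs[s s0 sV]] UV] : nbhs (dec p, dec q) A.
  exact: open_nbhs_nbhs.
have [n hn] := eps2_small r0; have [m hm] := eps2_small s0.
(* Long enough to contain the indices [n.*2] and [m.*2.+1], where term [n] of [p] and term [m] of
   [q] are stored. *)
exists (maxn n m).+1.*2 => z' zz' Q1 Q2; apply: UV; split=> /=.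
  apply: rU; apply: le_lt_trans hn; apply: (codes_uniq (codes_dec Qp) (codes_dec Q1)).
  have := zz' n.*2; rewrite -[pr _ _ _]/(pr1 (pr p q) n) pr1K; apply.
  by rewrite ltn_double ltnS leq_maxl.
apply: sV; apply: le_lt_trans hm; apply: (codes_uniq (codes_dec Qq) (codes_dec Q2)).
have := zz' m.*2.+1; rewrite -[pr _ _ _]/(pr2 (pr p q) m) pr2K; apply.
by rewrite -[(_ < _)%N]/(_ <= _)%N -doubleS leq_double ltnS leq_maxr.
Qed.

Lemma bor_dec (A : set X) : borel A -> bor [set p | A (dec p)].
Proof.
move=> bA; have bA1 : borel [set xy : X * X | A xy.1].
  exact: (borel_map_continuous (fun xy => cvg_fst) bA).
have := bor_pre (borfun_pr borfun_id borfun_id) (bor_dec2 bA1).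
by congr bor; apply/seteqP; split=> p /=; rewrite pr1K.
Qed.

Lemma coding_exists : exists (c : X -> baire) (D : baire -> X),
  [/\ forall x, D (c x) = x,
      forall A, bor A -> borel (c @^-1` A),
      bor [set p | c (D p) = p] &
      forall A : set (X * X), borel A -> bor [set z | A (D (pr1 z), D (pr2 z))]].
Proof.
exists code, dec; split; [exact: codeK|exact: bor_preimage_code| |exact: bor_dec2].
(* The range of [code] is the set of fixed points of [code] after [dec], a condition checked term by
   term. *)
have : bor [set p | forall n, code (dec p) n = p n].
  apply: (@sigma_all _ _ bor_sigma (fun n p => code (dec p) n = p n)) => n.
  apply: (@sigma_eq_count _ _ bor_sigma _ (fun p => code (dec p) n) (fun p => p n)).
    by move=> i; apply: (bor_dec (borel_code n i)).
  by move=> i; apply: bor_coord.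
by congr bor; apply/seteqP; split=> p /= h; [apply/funext|move=> n; rewrite h].
Qed.

End Coding.

Lemma polish_coding (R : realType) (X : topologicalType) : polish R X -> X ->
  exists (c : X -> baire) (D : baire -> X),
  [/\ forall x, D (c x) = x,
      forall A, bor A -> borel (c @^-1` A),
      bor [set p | c (D p) = p] &
      forall A : set (X * X), borel A -> bor [set z | A (D (pr1 z), D (pr2 z))]].
Proof.
move=> [[S cS dS] [d [md dX dc]]] x0.
have /countable_injP[u uinj] := cS.
pose e n := if pselect (exists x, S x /\ u x = n) is left h then projT1 (cid h) else x0.
have eP x : S x -> e (u x) = x.
  move=> Sx; rewrite /e; case: pselect => [h|[]]; last by exists x.
  by case: cid => y /= [Sy]; apply: uinj; rewrite inE.
apply: (@coding_exists R X d md dX dc e _ x0) => x r r0.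
have [|y [/= xy Sy]] := dS [set y | (d x y < r)%R] _ (open_metric_ball md dX x r).
  by exists x => /=; case: md => _ /(_ x x)[_ ->].
by exists (u y); rewrite eP.
Qed.

(** * Graph distance, and transfer of the result to the Polish space *)

Lemma gpath_rcons (T : Type) (G : set (T * T)) x y z n :
  gpath G x y n -> G (y, z) -> gpath G x z n.+1.
Proof.
move=> [q [q0 qn qG]] yz; exists (fun i => if i <= n then q i else z).
rewrite leq0n ltnn; split=> // i iltn; have [lt|ge] := ltnP i n.
  by rewrite (ltnW lt); apply: qG.
have -> : i = n by apply/eqP; rewrite eqn_leq ge andbT.
by rewrite leqnn qn.
Qed.

Lemma dist_gt_gpath (T : Type) (G : set (T * T)) x y n k :
  gpath G x y n -> dist_gt (gdist G x y) k -> k < n.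
Proof.
move=> h; rewrite /gdist; case: pselect => [ex|[]]; last by exists n.
by case: ex_minnP => m _ /(_ n (asboolT h)) mn /= km; apply: leq_trans mn.
Qed.

Theorem theorem1p4 (R : realType) (X : topologicalType) (hX : polish R X)
    (E : set (X * X)) (hE : cber E)
    (G : nat -> set (X * X))
    (Gincr : forall n, G n `<=` G n.+1)
    (Gborel : forall n, borel_graph (G n))
    (Gbdd : forall n, bounded_degree (G n))
    (GE : \bigcup_n G n = E)
    (f : nat -> nat)
    (hf : forall n, (2 * (f n + 1) <= f n.+1)%N)
    (B : nat -> set X)
    (Bborel : forall n, borel (B n))
    (Bsep : forall n, separated_in (G n) (f n) (B n)) :
  hyperfinite (restriction E [set x | infinite_set [set n | B n x]]).
Proof.
set Y := [set x | _]; have cY := cber_restriction Y hE.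
have [[x0]|X0] := pselect (inhabited X); last first.
  by apply: hyperfinite_empty cY => y; apply: X0; constructor; exact: (set_val y).
have [c [D [cK bc bP bD2]]] := polish_coding hX x0.
have [Erefl Esym Etrans] : is_equivalence E by case: hE.
pose P p := c (D p) = p.
(* The loops added here, also outside the range [P] of the coding, do not
   affect the distances between distinct points. *)
pose H n : set baire := [set z | pr1 z = pr2 z \/
  (P (pr1 z) /\ (P (pr2 z) /\ G n (D (pr1 z), D (pr2 z))))].
pose C n : set baire := [set p | P p /\ B n (D p)].
have Pc x : P (c x) by rewrite /P cK.
have HE n x y : H n (pr x y) <-> x = y \/ (P x /\ (P y /\ G n (D x, D y))).
  by rewrite /H /= pr1K pr2K.
have bH n : bor (H n).
  apply: (sigma_or bor_sigma); first exact: (bor_eqfun borfun_pr1 borfun_pr2).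
  apply: (sigma_and bor_sigma); first exact: (bor_pre borfun_pr1 bP).
  apply: (sigma_and bor_sigma); first exact: (bor_pre borfun_pr2 bP).
  by apply: bD2; case: (Gborel n).
have bC n : bor (C n).
  apply: (sigma_and bor_sigma) => //.
  have bB1 : borel [set xy : X * X | B n xy.1].
    exact: (borel_map_continuous (fun xy => cvg_fst) (Bborel n)).
  have := bor_pre (borfun_pr borfun_id borfun_id) (bD2 _ bB1).
  by congr bor; apply/seteqP; split=> p /=; rewrite pr1K.
have Hrefl n x : H n (pr x x) by apply/HE; left.
have Hsym n x y : H n (pr x y) -> H n (pr y x).
  move=> /HE[->//|[Px [Py xy]]]; apply/HE; right; split=> //; split=> //.
  by case: (Gborel n) => + _; apply.
have Hincr n : H n `<=` H n.+1.
  by move=> z [?|[? [? ?]]]; [left|right; split=> //; split=> //; apply: Gincr].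
have Hfin n x : finite_set [set y | H n (pr x y)].
  have fG : finite_set [set y | G n (D x, y)].
    by apply/finite_set_leP; have [k hk] := Gbdd n; exists k.
  have : finite_set ([set x] `|` c @` [set y | G n (D x, y)]).
    by rewrite finite_setU; split; [exact: finite_set1|exact: finite_image].
  apply: sub_finite_set => y /= /HE[->|[_ [Py xy]]]; [by left|right].
  by exists (D y).
(* The union of the [H n] is [E] on codes and equality elsewhere. *)
have HEG x y : (exists n, H n (pr x y)) <-> x = y \/ (P x /\ P y /\ E (D x, D y)).
  split=> [[n /HE[->|[Px [Py xy]]]]|[->|[Px [Py]]]]; first by left.
  - by right; rewrite -GE; split=> //; split=> //; exists n.
  - by exists 0.
  - by rewrite -GE => -[n _ xy]; exists n; apply/HE; right.
have Htrans n m x y z : H n (pr x y) -> H m (pr y z) -> exists k, H k (pr x z).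
  move=> xy yz; have /HEG xyE : exists k, H k (pr x y) by exists n.
  have /HEG yzE : exists k, H k (pr y z) by exists m.
  apply/HEG; case: xyE yzE => [->//|[Px [Py xy']]] [<-|[_ [Pz yz']]]; first by right.
  by right; split=> //; split=> //; apply: Etrans yz'.
have [g [bg gH]] := lusin_novikov_seq bH Hfin.
(* Steps along added loops are dropped, so the path in [G n] may be shorter than [k]. *)
have reachP n k x y : P x -> reach H n k x y ->
    P y /\ exists2 l, l <= k & gpath (G n) (D x) (D y) l.
  move=> Px; elim: k y => [y /= <-|k IH y /= [z [/IH[Pz [l lk xz]] /HE[<-|[_ [Py zy]]]]]].
  - by split=> //; exists 0 => //; exists (fun=> D x); split.
  - by split=> //; exists l => //; apply: leqW.
  - by split=> //; exists l.+1 => //; apply: gpath_rcons zy.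
have Csep n x y : C n x -> C n y -> reach H n (f n) x y -> x = y.
  move=> [Px Bx] [Py By] /(reachP _ _ _ _ Px)[_ [l lf xy]].
  rewrite -Px -Py; congr c; apply: contrapT => /(Bsep n _ _ Bx By)/(dist_gt_gpath xy).
  by rewrite ltnNge lf.
have [Phi [bPhi PhiE]] :=
  hyperfinite_core bH Hrefl Hsym Hincr Hfin Htrans bg gH hf bC Csep.
split=> //; exists (fun (y : set_type Y) m => `[< Phi (c (set_val y)) m >]); split.
  apply: borel_map_cantor => m.
  have := borel_map_continuous (@continuous_set_val X Y) (bc _ (bPhi m)).
  by congr borel; apply/seteqP; split=> y /asboolP.
move=> x y; have infx N : exists2 n, N <= n & C n (c (set_val x)).
  have /infinite_setE/(_ N)[n Nn Bn] : Y (set_val x) by exact: set_valP.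
  by exists n => //; split=> //; rewrite cK.
have xyE : E (set_val x, set_val y) <-> exists n, H n (pr (c (set_val x)) (c (set_val y))).
  split=> [h|/HEG[/(congr1 D)|[_ [_]]]]; rewrite ?cK//.
    by apply/HEG; right; rewrite !cK.
  by move=> ->; apply: Erefl.
rewrite /restriction /E0 /= xyE (PhiE _ _ infx); split=> -[N hN]; exists N => m /hN.
  exact: asbool_equiv_eq.
exact: asbool_eq_equiv.
Qed.
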